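(* Let $f(t,\mathbf{x},\mathbf{c})$ be a solution of the mean-field equation $$\partial_t f(t,\mathbf{x},\mathbf{c})+\nabla_{\mathbf{x}}\cdot\big(\mathbf{V}_{\epsilon_1,\epsilon_2}(t,\mathbf{x},\mathbf{c})\,f(t,\mathbf{x},\mathbf{c})\big)=0,$$ and assume that $\epsilon_1$ and $\epsilon_2$ are sufficiently large so that $\mathcal{A}_{\epsilon_1,\epsilon_2}(t,\mathbf{x},\mathbf{c},\mathbf{y},\mathbf{z})=1$ for all $\mathbf{x},\mathbf{y}\in\Omega_1$, $\mathbf{c},\mathbf{z}\in\Omega_2$ and $t\ge0$. Then, for all $k,j=1,\dots,d_1$, $$u_k(t)=u_k(0)\quad\text{for all } t\ge0,\qquad\text{and}\qquad E_{kj}(t)\longrightarrow u_k(0)\,u_j(0)\quad\text{as } t\to\infty.$$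
   Context: Let $\Omega_1\subseteq\mathbb{R}^{d_1}$ and $\Omega_2\subseteq\mathbb{R}^{d_2}$ be compact domains, $\Omega=\Omega_1\times\Omega_2$, and fix norms $\|\cdot\|$ on $\mathbb{R}^{d_1}$ and $\mathbb{R}^{d_2}$. For $\epsilon\ge0$ let $\chi_\epsilon(r)=1$ if $r\le\epsilon$ and $\chi_\epsilon(r)=0$ otherwise. The kernel and velocity field are $$\mathcal{A}_{\epsilon_1,\epsilon_2}(t,\mathbf{x},\mathbf{c},\mathbf{y},\mathbf{z})=\frac{\chi_{\epsilon_1}(\|\mathbf{y}-\mathbf{x}\|)\,\chi_{\epsilon_2}(\|\mathbf{z}-\mathbf{c}\|)}{\sigma(t,\mathbf{x},\mathbf{c})},\qquad \mathbf{V}_{\epsilon_1,\epsilon_2}(t,\mathbf{x},\mathbf{c})=\int_\Omega \mathcal{A}_{\epsilon_1,\epsilon_2}(t,\mathbf{x},\mathbf{c},\mathbf{y},\mathbf{z})\,(\mathbf{y}-\mathbf{x})\,f(t,\mathbf{y},\mathbf{z})\,\mathrm{d}\mathbf{z}\,\mathrm{d}\mathbf{y},$$ where either $\sigma\equiv1$ (symmetric interactions) or $\sigma(t,\mathbf{x},\mathbf{c})=\int_\Omega\chi_{\epsilon_1}(\|\mathbf{y}-\mathbf{x}\|)\chi_{\epsilon_2}(\|\mathbf{z}-\mathbf{c}\|)f(t,\mathbf{y},\mathbf{z})\,\mathrm{d}\mathbf{z}\,\mathrm{d}\mathbf{y}$ (non-symmetric interactions). A solution $f$ is a family $f(t,\cdot,\cdot)$,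 $t\ge0$, of probability distributions on $\Omega$ satisfying the equation in weak form: for all test functions $\varphi\in C^1_0(\Omega)$ (continuous, compactly supported functions on the compact set $\Omega$ with continuous derivative, so that in particular restrictions to $\Omega$ of polynomials are admissible), $$\frac{\mathrm{d}}{\mathrm{d}t}\int_\Omega\varphi\, f(t,\mathbf{x},\mathbf{c})\,\mathrm{d}\mathbf{x}\,\mathrm{d}\mathbf{c}=\int_\Omega \mathbf{V}_{\epsilon_1,\epsilon_2}(t,\mathbf{x},\mathbf{c})\cdot\nabla_{\mathbf{x}}\varphi(\mathbf{x},\mathbf{c})\,f(t,\mathbf{x},\mathbf{c})\,\mathrm{d}\mathbf{x}\,\mathrm{d}\mathbf{c},\qquad t\ge0.$$ (Densities may be measures; $f\,\mathrm{d}\mathbf{x}\,\mathrm{d}\mathbf{c}$ denotes integration against them.) Moments: $u_k(t)=\int_\Omega x_k\,f(t,\mathbf{x},\mathbf{c})\,\mathrm{d}\mathbf{x}\,\mathrm{d}\mathbf{c}$ and $E_{kj}(t)=\int_\Omega x_kx_j\,f(t,\mathbf{x},\mathbf{c})\,\mathrm{d}\mathbf{x}\,\mathrm{d}\mathbf{c}$ for $k,j=1,\dots,d_1$. *)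

(* Defs.v *)
From HB Require Import structures.
From mathcomp Require Import all_boot all_order all_algebra.
From mathcomp Require Import all_classical all_reals all_analysis.
Set Implicit Arguments.
Unset Strict Implicit.
Unset Printing Implicit Defensive.
Import Order.TTheory GRing.Theory Num.Theory.
Import numFieldNormedType.Exports.
Local Open Scope classical_set_scope.
Local Open Scope ring_scope.

(* R^d1 x R^d2 with its Borel sigma-algebra.  The ambient topology comes from
   the sup norm; it does not depend on the norms of the interaction kernel. *)
Notation borel_space R d1 d2 :=
  (g_sigma_algebraType (@open ('rV[R]_d1 * 'rV[R]_d2)%type)).

(* Nonnegativity follows from these axioms. *)
Definition is_norm (R : realType) (V : lmodType R) (N : V -> R) : Prop :=
  [/\ forall x, N x = 0 -> x = 0,
      forall x y, N (x + y) <= N x + N y &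
      forall (a : R) x, N (a *: x) = `|a| * N x].

Definition chi (R : realType) (eps r : R) : R := if r <= eps then 1 else 0.

Variant interaction := Symmetric | NonSymmetric.

Section MeanField.
Context (R : realType) (d1 d2 : nat).
Context (Omega1 : set 'rV[R]_d1) (Omega2 : set 'rV[R]_d2).
Context (N1 : 'rV[R]_d1 -> R) (N2 : 'rV[R]_d2 -> R).
Context (kind : interaction) (eps1 eps2 : R).

(* f t is the distribution at time t, as a Borel probability measure on the
   ambient space; only t >= 0 matters, and [is_solution] requires f t to be
   carried by Omega. *)
Context (f : R -> probability (borel_space R d1 d2) R).

Definition Omega : set (borel_space R d1 d2) := Omega1 `*` Omega2.

Definition sigma (t : R) (x : 'rV[R]_d1) (c : 'rV[R]_d2) : R :=
  match kind with
  | Symmetric => 1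
  | NonSymmetric =>
      \int[f t]_(q in Omega)
        (chi eps1 (N1 (q.1 - x)) * chi eps2 (N2 (q.2 - c)))
  end.

Definition kernelA (t : R) (x : 'rV[R]_d1) (c : 'rV[R]_d2)
    (y : 'rV[R]_d1) (z : 'rV[R]_d2) : R :=
  chi eps1 (N1 (y - x)) * chi eps2 (N2 (z - c)) / sigma t x c.

Definition velocity (t : R) (x : 'rV[R]_d1) (c : 'rV[R]_d2) : 'rV[R]_d1 :=
  \row_i \int[f t]_(q in Omega)
           (kernelA t x c q.1 q.2 * (q.1 - x) 0 i).

(* C^1 functions on the compact set Omega: those that are C^1 on an open
   neighbourhood of it.  Compactness of the support in Omega is automatic, and
   no boundary condition is imposed. *)
Definition test_function (phi : 'rV[R]_d1 * 'rV[R]_d2 -> R) : Prop :=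
  exists U : set ('rV[R]_d1 * 'rV[R]_d2),
    [/\ open U, Omega `<=` U &
        forall p, U p -> differentiable phi p /\
          forall v, {for p, continuous (fun q => 'D_v phi q)}].

Definition grad_x (phi : 'rV[R]_d1 * 'rV[R]_d2 -> R)
    (p : 'rV[R]_d1 * 'rV[R]_d2) : 'rV[R]_d1 :=
  \row_i 'D_(delta_mx 0 i, 0) phi p.

(* Derivative relative to the time interval [0, +oo[, hence one-sided at 0. *)
Definition time_derivative (g : R -> R) (t l : R) : Prop :=
  (g s - g t) / (s - t) @[s --> within [set s | 0 <= s] t^'] --> l.

Definition is_solution : Prop :=
  (forall t, 0 <= t -> f t Omega = 1%E) /\
  (forall phi, test_function phi -> forall t, 0 <= t ->
     time_derivative
       (fun s => \int[f s]_(p in Omega) phi p) t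
       (\int[f t]_(p in Omega)
          (\sum_i velocity t p.1 p.2 0 i * grad_x phi p 0 i))).

Definition mean_u (k : 'I_d1) (t : R) : R :=
  \int[f t]_(p in Omega) (p.1 0 k).

Definition moment_E (k j : 'I_d1) (t : R) : R :=
  \int[f t]_(p in Omega) (p.1 0 k * p.1 0 j).

End MeanField.

(* Main.v *)
Require Import Defs.
From HB Require Import structures.
From mathcomp Require Import all_boot all_order all_algebra.
From mathcomp Require Import all_classical all_reals all_analysis.
From mathcomp Require Import ring.
Set Implicit Arguments.
Unset Strict Implicit.
Unset Printing Implicit Defensive.
Import Order.TTheory GRing.Theory Num.Theory.
Import numFieldNormedType.Exports.
Local Open Scope classical_set_scope.
Local Open Scope ring_scope.

(** When every interaction weight is 1, an agent at [x] sees the whole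
population, so the velocity at [x] is [u(t) - x]: total mass 1 gives the [- x]
([velocityE]).  The weak equation then closes on the moments.  Testing it
against [x_k] gives [u_k' = \int (u_k - x_k) = 0] ([time_derivative_mean]);
testing it against [x_k x_j] gives
[E_kj' = \int ((u_k - x_k) x_j + (u_j - x_j) x_k) = - 2 (E_kj - u_k u_j)]
([time_derivative_moment]).  Both are instances of the scalar equation
[g' = - a (g - b)], whose only solution is
[g t = b + (g 0 - b) exp (- a t)] ([linear_ode_solution]): the case [a = 0]
says that [u_k] is constant, and once this is known the case [a = 2],
[b = u_k(0) u_j(0)] says that [E_kj] converges to [b] exponentially fast.

The integrals split linearly because a continuous function is Borel and is
bounded on the compact set [Omega], hence integrable
([borel_continuous_integrable]). *)

(** * Linear scalar equations on the half-line *)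

(** Away from the endpoint the restriction to [[0, +oo[] is invisible, since a
ball of radius [t] around [t] stays in the half-line. *)
Lemma is_derive_time_derivative (R : realType) (g : R -> R) (t l : R) :
  0 < t -> time_derivative g t l -> is_derive t 1 g l.
Proof.
move=> t0 gl.
suff D : h^-1 *: ((g \o shift t) (h *: 1) - g t) @[h --> 0^'] --> l.
  by apply: DeriveDef; [apply/cvg_ex; exists l|exact: cvg_lim D].
have /cvgrPdist_lt gl' := gl.
apply/cvgrPdist_lt => e e0.
have [d /= d0 dP] := gl' e e0.
exists (Num.min d t) => /=; first by rewrite lt_min d0.
move=> h /=; rewrite sub0r normrN lt_min => /andP[hd ht] h0.
have := dP (h + t); rewrite /= opprD addrCA subrr addr0 normrN => /(_ hd).
rewrite addrK -subr_eq0 addrK [h%:A]mulr1 mulrC => -> //.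
by rewrite -lerBlDr sub0r lerNnormlW// ltW.
Qed.

(** At the endpoint only right continuity is available; it is what the mean
value theorem needs there. *)
Lemma cvg_at_right0_time_derivative (R : realType) (g : R -> R) (l : R) :
  time_derivative g 0 l -> g s @[s --> 0^'+] --> g 0.
Proof.
move=> gl.
have q : (g s - g 0) / (s - 0) @[s --> 0^'+] --> l.
  refine (cvg_trans _ gl) => A [d /= d0 dA].
  by exists d => //= s sd s0; apply: dA; rewrite //= ?gt_eqF// ltW.
have s0 : (s : R) @[s --> 0^'+] --> (0 : R) by apply: cvg_within_filter; exact: cvg_id.
have : (g s - g 0) / (s - 0) * s + g 0 @[s --> 0^'+] --> l * 0 + g 0.
  by apply: cvgD; [exact: cvgM|exact: cvg_cst].
rewrite mulr0 add0r; apply: cvg_trans.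
apply: near_eq_cvg; near=> s.
by rewrite /= subr0 divfK ?subrK// gt_eqF.
Unshelve. all: by end_near. Qed.

(** The integrating factor [expR (a * s)] turns the equation into
[((g s - b) * expR (a * s))' = 0], and the mean value theorem on [[0, t]]
concludes. *)
Lemma linear_ode_solution (R : realType) (g : R -> R) (a b : R) :
  (forall t : R, 0 <= t -> time_derivative g t (- (a * (g t - b)))) ->
  forall t : R, 0 <= t -> g t = b + (g 0 - b) * expR (- (a * t)).
Proof.
move=> dg t; rewrite le_eqVlt => /predU1P[<-|t0].
  by rewrite mulr0 oppr0 expR0 mulr1 addrC subrK.
pose h s := (g s - b) * expR (a * s).
have dh (s : R) : 0 < s -> is_derive s 1 h 0.
  move=> s0; have Dg := is_derive_time_derivative s0 (dg s (ltW s0)).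
  have De : is_derive s 1 (expR \o *%R a) (a * expR (a * s)).
    apply: is_derive_eq; rewrite mulrC; congr (_ * _).
    by rewrite -[RHS]mulr1.
  apply: is_derive_eq (is_deriveM _ De) _.
  by rewrite subr0 /GRing.scale/=; ring.
have ch (s : R) : 0 < s -> {for s, continuous h}.
  move=> /dh[Dh _]; apply: differentiable_continuous.
  exact/derivable1_diffP.
have h0 : h s @[s --> 0^'+] --> h 0.
  apply: cvgM.
    apply: cvgB; last exact: cvg_cst.
    exact: cvg_at_right0_time_derivative (dg _ (lexx 0)).
  apply: cvg_at_right_filter.
  apply: continuous_comp; first exact: mulrl_continuous.
  exact: continuous_expR.
have : h t - h 0 = 0.
  have [|//|c _] := @MVT R h (cst 0) 0 t t0.
  - by move=> s; rewrite in_itv/= => /andP[/dh].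
  - apply/continuous_within_itvP => //; split=> //.
      by move=> s; rewrite in_itv/= => /andP[/ch].
    by apply: cvg_at_left_filter; exact: ch.
  - by rewrite /cst mul0r.
move/subr0_eq; rewrite /h mulr0 expR0 mulr1 => <-.
by rewrite -mulrA -expRD subrr expR0 mulr1 addrC subrK.
Qed.

Lemma cvg_exp_decay (R : realType) (g : R -> R) (a b : R) : 0 < a ->
  (forall t : R, 0 <= t -> g t = b + (g 0 - b) * expR (- (a * t))) ->
  g t @[t --> +oo] --> b.
Proof.
move=> a0 gE.
have e0 : expR (- (a * t)) @[t --> +oo] --> (0 : R).
  apply: (cvg_comp (fun t : R => a * t) (fun t => expR (- t)) _ (@cvgr_expR R)).
  by apply: gt0_cvgMry => //; exact: cvg_id.
have : b + (g 0 - b) * expR (- (a * t)) @[t --> +oo] --> b + (g 0 - b) * 0.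
  by apply: cvgD; [exact: cvg_cst|apply: cvgM => //; exact: cvg_cst].
rewrite mulr0 addr0; apply: cvg_trans; apply: near_eq_cvg; near=> t.
by rewrite /= -gE.
Unshelve. all: by end_near. Qed.

(** * Continuous functions on compact sets and Borel probabilities *)

Lemma borel_closed (R : realType) (T : normedModType R) (A : set T) :
  closed A -> measurable (A : set (g_sigma_algebraType (@open T))).
Proof.
move=> cA; rewrite -(setCK A); apply: measurableC.
by apply: sub_sigma_algebra; exact: closed_openC.
Qed.

Lemma borel_continuous_measurable (R : realType) (T : normedModType R)
    (phi : T -> R) :
  continuous phi ->
  measurable_fun setT (phi : g_sigma_algebraType (@open T) -> R).
Proof.
move=> /continuousP cphi.
apply: (measurability _ (measurable_realfun.RGenOpens.measurableE R)).
move=> _ [_ [a [b ->] <-]]; rewrite setTI.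
by apply: sub_sigma_algebra; exact/cphi/interval_open.
Qed.

Lemma borel_continuous_integrable (R : realType) (T : normedModType R)
    (mu : probability (g_sigma_algebraType (@open T)) R) (K : set T)
    (phi : T -> R) :
  compact K -> continuous phi ->
  mu.-integrable K (EFin \o phi).
Proof.
move=> cK cphi.
have mK := borel_closed (compact_closed (@norm_hausdorff _ T) cK).
apply: measurable_bounded_integrable => //.
- by rewrite (le_lt_trans (probability_le1 _ mK)) ?ltry.
- by apply: measurable_funTS; exact: borel_continuous_measurable.
- have : compact (phi @` K).
    by apply: continuous_compact => //; exact: continuous_subspaceT.
  move=> /compact_bounded [M [Mr MP]]; exists M; split=> // N /MP PN x Kx.
  by apply: PN; exists x.
Qed.

(** * The spatial coordinates as test functions *)

Lemma linear_derivative (R : realType) (V : normedModType R)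
    (phi : {linear V -> R}) (p v : V) :
  continuous phi -> is_derive p v phi (phi v).
Proof.
move=> cphi; have dphi := linear_differentiable p cphi.
by apply: DeriveDef; [exact: diff_derivable|rewrite deriveE// diff_lin].
Qed.

Section Coordinates.
Context (R : realType) (d1 d2 : nat).
Local Notation V := ('rV[R]_d1 * 'rV[R]_d2)%type.

(** Naming the coordinate lets it carry a linear structure, from which its
derivative is obtained. *)
Definition coord_x (k : 'I_d1) (p : V) : R := p.1 0 k.

Lemma coord_x_is_linear k : linear (coord_x k).
Proof. by move=> a p q; rewrite /coord_x !mxE. Qed.

HB.instance Definition _ k :=
  GRing.isLinear.Build R V R _ (coord_x k) (@coord_x_is_linear k).

Lemma continuous_coord_x k : continuous (coord_x k).
Proof.
move=> p; apply: (@continuous_comp _ _ _ fst (fun M : 'rV[R]_d1 => M 0 k)).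
  exact: cvg_fst.
exact: coord_continuous.
Qed.

Lemma is_derive_coord_x k (p v : V) : is_derive p v (coord_x k) (coord_x k v).
Proof. exact/linear_derivative/continuous_coord_x. Qed.

Lemma is_derive_coord_xM k j (p v : V) :
  is_derive p v (coord_x k * coord_x j)
    (coord_x k p * coord_x j v + coord_x j p * coord_x k v).
Proof. exact: is_deriveM (is_derive_coord_x k p v) (is_derive_coord_x j p v). Qed.

Lemma continuous_coord_xM k j : continuous (coord_x k * coord_x j).
Proof. by move=> p; apply: cvgM; exact: continuous_coord_x. Qed.

Lemma test_function_coord_x (Omega1 : set 'rV[R]_d1) (Omega2 : set 'rV[R]_d2) k :
  test_function Omega1 Omega2 (coord_x k).
Proof.
exists setT; split=> //; first exact: openT.
move=> p _; split=> [|v].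
  exact/linear_differentiable/continuous_coord_x.
rewrite (_ : 'D_v _ = cst (coord_x k v)); first exact: cvg_cst.
by apply/funext => q; exact: (@derive_val _ _ _ _ _ _ _ (is_derive_coord_x k q v)).
Qed.

Lemma test_function_coord_xM (Omega1 : set 'rV[R]_d1) (Omega2 : set 'rV[R]_d2)
    k j :
  test_function Omega1 Omega2 (coord_x k * coord_x j).
Proof.
exists setT; split=> //; first exact: openT.
move=> p _; split=> [|v].
  by apply: differentiableM; exact/linear_differentiable/continuous_coord_x.
rewrite (_ : 'D_v _ =
    fun q => coord_x k q * coord_x j v + coord_x j q * coord_x k v); last first.
  by apply/funext => q; exact: (@derive_val _ _ _ _ _ _ _ (is_derive_coord_xM k j q v)).
apply: cvgD; apply: cvgM; first exact: continuous_coord_x.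
- exact: cvg_cst.
- exact: continuous_coord_x.
- exact: cvg_cst.
Qed.

Lemma coord_x_delta k i : coord_x k (delta_mx 0 i, 0) = (i == k)%:R.
Proof. by rewrite /coord_x mxE eqxx eq_sym. Qed.

Lemma grad_coord_x k p i : grad_x (coord_x k) p 0 i = (i == k)%:R.
Proof.
by rewrite mxE (@derive_val _ _ _ _ _ _ _ (is_derive_coord_x k _ _)) coord_x_delta.
Qed.

Lemma grad_coord_xM k j p i :
  grad_x (coord_x k * coord_x j) p 0 i =
  coord_x k p * (i == j)%:R + coord_x j p * (i == k)%:R.
Proof.
by rewrite mxE (@derive_val _ _ _ _ _ _ _ (is_derive_coord_xM k j _ _)) !coord_x_delta.
Qed.

End Coordinates.

(** * Moments under all-to-all interaction *)

Section AllToAll.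
Context (R : realType) (d1 d2 : nat).
Context (Omega1 : set 'rV[R]_d1) (Omega2 : set 'rV[R]_d2).
Context (N1 : 'rV[R]_d1 -> R) (N2 : 'rV[R]_d2 -> R).
Context (kind : interaction) (eps1 eps2 : R).
Context (f : R -> probability (borel_space R d1 d2) R).
Hypotheses (cO1 : compact Omega1) (cO2 : compact Omega2).
Hypothesis sol : is_solution Omega1 Omega2 N1 N2 kind eps1 eps2 f.
Hypothesis kernel1 : forall (t : R) x c y z, 0 <= t ->
  Omega1 x -> Omega2 c -> Omega1 y -> Omega2 z ->
  kernelA Omega1 Omega2 N1 N2 kind eps1 eps2 f t x c y z = 1.

Local Notation O := (Omega Omega1 Omega2).
Local Notation u := (mean_u Omega1 Omega2 f).
Local Notation E := (moment_E Omega1 Omega2 f).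

Lemma integrable_Omega t (phi : 'rV[R]_d1 * 'rV[R]_d2 -> R) :
  continuous phi -> (f t).-integrable O (EFin \o phi).
Proof.
by apply: borel_continuous_integrable; exact: compact_setX.
Qed.

Lemma measurable_Omega : measurable O.
Proof.
apply: borel_closed; apply: compact_closed; last exact: compact_setX.
exact: norm_hausdorff.
Qed.

Lemma Rintegral_Omega_cst t (r : R) : 0 <= t -> \int[f t]_(p in O) r = r.
Proof.
move=> t0; rewrite Rintegral_cst; last exact: measurable_Omega.
rewrite -[RHS]mulr1; congr (_ * _).
have fine1 (z : \bar R) : z = 1%E -> fine z = 1 by move=> ->.
by apply: fine1; exact: sol.1 t t0.
Qed.

(** On [Omega] the kernel is 1, for either kind of interaction, so the velocity
integrates [q.1 - x] against a probability measure. *)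
Lemma velocityE t p i : 0 <= t -> O p ->
  velocity Omega1 Omega2 N1 N2 kind eps1 eps2 f t p.1 p.2 0 i
  = u i t - coord_x i p.
Proof.
move=> t0 [Op1 Op2]; rewrite mxE.
under eq_Rintegral => q.
  rewrite inE => -[Oq1 Oq2]; rewrite kernel1// mul1r !mxE; over.
rewrite RintegralB.
- by rewrite Rintegral_Omega_cst.
- exact: measurable_Omega.
- exact/integrable_Omega/continuous_coord_x.
- by apply: integrable_Omega => q; exact: cvg_cst.
Qed.

(** Averaging [u - x] over the population gives [u - u]: the test function
[x_k] extracts this average. *)
Lemma time_derivative_mean k t : 0 <= t -> time_derivative (u k) t 0.
Proof.
move=> t0; have := sol.2 _ (test_function_coord_x Omega1 Omega2 k) t t0.
congr time_derivative.
transitivity (\int[f t]_(p in O) (u k t - coord_x k p)).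
  apply: eq_Rintegral => p; rewrite inE => Op.
  rewrite (bigD1 k)//= big1 => [|i /negbTE ik].
    by rewrite velocityE// grad_coord_x eqxx mulr1 addr0.
  by rewrite grad_coord_x ik mulr0.
rewrite RintegralB.
- by rewrite Rintegral_Omega_cst// subrr.
- exact: measurable_Omega.
- by apply: integrable_Omega => q; exact: cvg_cst.
- exact/integrable_Omega/continuous_coord_x.
Qed.

(** The linear terms of [(u_k - x_k) x_j + (u_j - x_j) x_k] integrate to
[u_k u_j] each and the quadratic ones to [E_kj] each, whence the rate 2. *)
Lemma time_derivative_moment k j t : 0 <= t ->
  time_derivative (E k j) t (- (2 * (E k j t - u k t * u j t))).
Proof.
move=> t0; have := sol.2 _ (test_function_coord_xM Omega1 Omega2 k j) t t0.
congr time_derivative.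
pose x := @coord_x R d1 d2.
transitivity (\int[f t]_(p in O)
    (u j t * x k p + u k t * x j p - 2 * (x k p * x j p))).
  apply: eq_Rintegral => p; rewrite inE => Op.
  under eq_bigr do rewrite velocityE// grad_coord_xM mulrDr.
  rewrite big_split/= (bigD1 j)//= big1 => [|i /negbTE ->]; last first.
    by rewrite !mulr0.
  rewrite (bigD1 k)//= big1 => [|i /negbTE ->]; last by rewrite !mulr0.
  rewrite !eqxx /x !mulr1 !addr0; ring.
have mO := measurable_Omega.
have cx := @continuous_coord_x R d1 d2.
have iZ r (phi : _ -> R) : continuous phi ->
    (f t).-integrable O (EFin \o (fun p => r * phi p)).
  move=> cphi; apply: integrable_Omega => p.
  by apply: cvgM; [exact: cvg_cst|exact: cphi].
have cD : continuous (fun p => u j t * x k p + u k t * x j p).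
  by move=> p; apply: cvgD; apply: cvgM; try exact: cvg_cst; exact: cx.
rewrite RintegralB//; [|exact: integrable_Omega|exact/iZ/continuous_coord_xM].
rewrite RintegralD//; [|exact/iZ/cx|exact/iZ/cx].
rewrite !RintegralZl//; try exact/integrable_Omega/cx;
  try exact/integrable_Omega/continuous_coord_xM.
rewrite -/(u k t) -/(u j t) -/(E k j t); ring.
Qed.

End AllToAll.

Theorem corollary3p2 (R : realType) (d1 d2 : nat)
    (Omega1 : set 'rV[R]_d1) (Omega2 : set 'rV[R]_d2)
    (N1 : 'rV[R]_d1 -> R) (N2 : 'rV[R]_d2 -> R)
    (kind : interaction) (eps1 eps2 : R)
    (f : R -> probability (borel_space R d1 d2) R) :
  compact Omega1 -> compact Omega2 ->
  is_norm N1 -> is_norm N2 ->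
  0 <= eps1 -> 0 <= eps2 ->
  is_solution Omega1 Omega2 N1 N2 kind eps1 eps2 f ->
  (forall (t : R) x c y z, 0 <= t -> Omega1 x -> Omega2 c -> Omega1 y -> Omega2 z ->
     kernelA Omega1 Omega2 N1 N2 kind eps1 eps2 f t x c y z = 1) ->
  forall k j : 'I_d1,
    (forall t : R, 0 <= t ->
       mean_u Omega1 Omega2 f k t = mean_u Omega1 Omega2 f k 0) /\
    moment_E Omega1 Omega2 f k j t @[t --> +oo] -->
      mean_u Omega1 Omega2 f k 0 * mean_u Omega1 Omega2 f j 0.
Proof.
move=> cO1 cO2 _ _ _ _ sol kernel1 k j.
have u_const i (t : R) : 0 <= t ->
    mean_u Omega1 Omega2 f i t = mean_u Omega1 Omega2 f i 0.
  move=> t0; rewrite (@linear_ode_solution R (mean_u Omega1 Omega2 f i) 0 0 _ t t0).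
    by rewrite mul0r oppr0 expR0 mulr1 add0r addr0.
  move=> s s0; rewrite mul0r oppr0.
  exact: time_derivative_mean cO1 cO2 sol kernel1 i s s0.
split; first exact: u_const.
apply: (@cvg_exp_decay R _ 2) => //.
apply: linear_ode_solution => t t0.
rewrite -(u_const k t t0) -(u_const j t t0).
exact: time_derivative_moment cO1 cO2 sol kernel1 k j t t0.
Qed.
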